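(* Let $p\ge 5$ be prime and let $G$ be a primitive but not $2$-fold transitive permutation group of degree $3p$. If $G$ is of Type II, then for some integer $a\ge 0$ either (i) $p=48a^2+30a+5$ and the subdegrees of $G$ are $1,\ p+4a+1,\ 2p-4a-2$; or (ii) $p=48a^2+66a+23$ and the subdegrees of $G$ are $1,\ p-4a-3,\ 2p+4a+2$.
   Context: Let $\pi$ denote the (complex) permutation character of $G$. $G$ is of Type II if $\pi=1_G+\chi_1+\chi_2$ where $\chi_1,\chi_2$ are distinct irreducible characters of $G$ of degrees $\deg\chi_1=p$ and $\deg\chi_2=2p-1$. The subdegrees of $G$ are the lengths of the orbits (suborbits) of a point stabiliser. *)

(* Defs.v *)
From mathcomp Require Import all_boot all_order all_algebra all_fingroup.
From mathcomp Require Import all_solvable all_field all_character.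

Set Implicit Arguments.
Unset Strict Implicit.
Unset Printing Implicit Defensive.

Import GroupScope GRing.Theory.
Local Open Scope ring_scope.

Section PermutationCharacter.

Variables (T : finType) (G : {group {perm T}}).

Fact perm_char_subproof :
  is_class_fun <<G>> [ffun g => #|'Fix_'P[g]|%:R *+ (g \in G)].
Proof.
rewrite genGid; apply: intro_class_fun => [g h Gg Gh | g /negbTE-> //].
rewrite groupJ // Gg !mulr1n; congr (_%:R).
have <-: (fun t => h t) @: 'Fix_'P[g] = 'Fix_'P[(g ^ h)%g].
  apply/setP=> t; apply/imsetP/afix1P => [[u /afix1P gu ->] | /= ght].
    by move: gu; rewrite /= /aperm permJ => ->.
  exists ((h^-1)%g t); last by rewrite permKV.
  apply/afix1P; rewrite /= /aperm; apply: (@perm_inj _ h).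
  by rewrite -permJ permKV.
by rewrite card_imset //; apply: perm_inj.
Qed.

(* By the class function convention, the value outside G is 0. *)
Definition perm_char : 'CF(G) := Cfun 0 perm_char_subproof.

Lemma perm_charE g : g \in G -> perm_char g = #|'Fix_'P[g]|%:R.
Proof. by move=> Gg; rewrite cfunE Gg. Qed.

End PermutationCharacter.

Definition typeII (T : finType) (p : nat) (G : {group {perm T}}) : Prop :=
  exists i j : Iirr G,
    [/\ i != j, perm_char G = 1 + 'chi_i + 'chi_j,
        'chi_i 1%g = p%:R & 'chi_j 1%g = (2 * p - 1)%:R].

Definition suborbits (T : finType) (G : {group {perm T}}) (x : T) :
    {set {set T}} :=
  [set orbit 'P 'C_G[x | 'P] y | y : T].

(* A list with multiplicity: distinct suborbits may have the same length. *)
Definition subdegrees (T : finType) (G : {group {perm T}}) (x : T) : seq nat :=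
  [seq #|(B : {set T})| | B <- enum (suborbits G x)].

(* Main.v *)
Require Import Defs.
From mathcomp Require Import all_boot all_order all_algebra all_fingroup.
From mathcomp Require Import all_solvable all_field all_character.
From mathcomp Require Import zify ring.

(* Let A be the adjacency matrix of a nontrivial orbital.  The group-algebra
   idempotents of the constituents of the permutation character act on functions
   on T as orthogonal idempotents with traces 1, p, 2p - 1; since there are as many
   suborbits as constituents, they span the G-invariant matrices.  Hence A has
   eigenvalues k, r, s with multiplicities 1, p, 2p - 1.  Here r and s are the roots
   of an integral monic quadratic and p r + (2p - 1) s = -k, so r and s are integers.
   The traces of A and A^2 give k + p r + (2p - 1) s = 0 and
   k^2 + p r^2 + (2p - 1) s^2 = 3 p k (were the orbital not symmetric, A^2 would have
   trace 0, impossible for real r and s).  With t = -(r + 2s) this becomes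
   6 s^2 + 6 s t + t^2 - 3 s = p t (3 - t), which forces t = 1 or 2 (exchanged by
   passing to the complementary orbital); for t = 1, 2 p = 6 s^2 + 3 s + 1 and
   k = p + s, and s = 1 mod 4 because p is odd. *)

Set Implicit Arguments.
Unset Strict Implicit.
Unset Printing Implicit Defensive.

(** * Suborbits under a change of base point *)

Section Suborbits.
Import Order.TTheory GRing.Theory Num.Theory.
Local Open Scope ring_scope.

Variables (T : finType) (G : {group {perm T}}).
Implicit Types (x y z : T) (g h : {perm T}).

Lemma mem_suborbit x y z :
  reflect (exists2 h, h \in G & h x = x /\ h y = z)
          (z \in orbit 'P ('C_G[x | 'P])%g y).
Proof.
apply: (iffP imsetP) => [[h /setIP[Gh /astab1P hx] ->]|[h Gh [hx <-]]].
  by exists h.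
by exists h => //; rewrite inE Gh; apply/astab1P.
Qed.

Lemma suborbits_partition x : partition (suborbits G x) [set: T].
Proof.
have -> : suborbits G x = orbit 'P ('C_G[x | 'P])%g @: [set: T].
  by apply/setP => B; apply/imsetP/imsetP => -[y _ ->]; exists y.
by apply: orbit_partition; apply/actsP => g _ y; rewrite !inE.
Qed.

Lemma suborbit_self x : orbit 'P ('C_G[x | 'P])%g x = [set x].
Proof.
apply/setP => y; rewrite inE; apply/mem_suborbit/eqP => [[h _ [hx <-]]|->] //.
by exists 1%g; rewrite ?group1 // !perm1.
Qed.

Lemma suborbits_perm g x :
  g \in G -> suborbits G (g x) = (fun B : {set T} => g @: B) @: suborbits G x.
Proof.
move=> Gg.
have im y : orbit 'P ('C_G[g x | 'P])%g (g y) = g @: orbit 'P ('C_G[x | 'P])%g y.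
  apply/setP => z; apply/mem_suborbit/imsetP.
    case=> h Gh [hx hz]; exists (g^-1 z)%g; last by rewrite permKV.
    apply/mem_suborbit; exists (g * h * g^-1)%g; first by rewrite !groupM ?groupV.
    by rewrite !permM hx hz permK.
  case=> w /mem_suborbit[h Gh [hx <-]] ->.
  exists (g^-1 * h * g)%g; first by rewrite !groupM ?groupV.
  by rewrite !permM !permK hx.
apply/setP => B; apply/imsetP/imsetP => [[y _ ->]|[_ /imsetP[y _ ->] ->]].
  exists (orbit 'P ('C_G[x | 'P])%g (g^-1 y)%g); first by apply: imset_f.
  by rewrite -im permKV.
by exists (g y) => //; rewrite im.
Qed.

(** For transitive [G] this carries the subdegrees found at one point to all points. *)
Lemma subdegrees_perm g x :
  g \in G -> perm_eq (subdegrees G (g x)) (subdegrees G x).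
Proof.
move=> Gg; have inj := imset_inj (@perm_inj _ g).
have E : perm_eq (enum (suborbits G (g x)))
    [seq g @: (B : {set T}) | B <- enum (suborbits G x)].
  apply: uniq_perm; rewrite ?enum_uniq ?map_inj_uniq ?enum_uniq // => B.
  rewrite mem_enum suborbits_perm //.
  by apply/imsetP/mapP => -[C CS ->]; exists C; rewrite // ?mem_enum // -mem_enum.
rewrite /subdegrees (perm_trans (perm_map _ E)) // -map_comp.
rewrite (eq_map (g := fun B : {set T} => #|B|)) // => B /=.
by rewrite card_imset //; apply: perm_inj.
Qed.
End Suborbits.

(** * Integer solutions of the trace equations *)

Section Arithmetic.
Import GRing.Theory.
Local Open Scope ring_scope.

(* A residue s = 3 mod 4 would make p even. *)
Lemma odd_quadratic_value (p : nat) (s : int) : odd p ->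
  2 * p%:Z = 6 * s ^+ 2 + 3 * s + 1 -> exists a : nat,
    (s = 4 * a%:Z + 1 /\ p = (48 * a ^ 2 + 30 * a + 5)%N) \/
    (s = - 4 * a%:Z - 3 /\ p = (48 * a ^ 2 + 66 * a + 23)%N).
Proof.
move=> podd e.
have [m [c [c4 sE]]] : exists m : int, exists c : nat, (c < 4)%N /\ s = 4 * m + c%:Z.
  by exists (s %/ 4)%Z, `|(s %% 4)%Z|%N; lia.
have [u uE] : exists u : nat, p = (2 * u + 1)%N by exists (p./2); lia.
(* Modulo 4 the left side is 2, while the right side is 1, 2, 3, 0 for [c] = 0, 1, 2, 3. *)
have {c c4} sE : s = 4 * m + 1.
  move: e; rewrite sE uE => e; clear -c4 e.
  have {}e : 4 * u%:Z + 2 = 96 * (m * m) + 48 * (m * c%:Z) + 6 * (c%:Z * c%:Z) + 12 * m + 3 * c%:Z + 1.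
    by rewrite -[RHS](_ : 6 * (4 * m + c%:Z) ^+ 2 + 3 * (4 * m + c%:Z) + 1 = _); [lia|ring].
  by case: c c4 e => [|[|[|[|]]]] //= _; lia.
have {}e : p%:Z = 48 * (m * m) + 30 * m + 5.
  have : 2 * p%:Z = 2 * (48 * (m * m) + 30 * m + 5) by rewrite e sE; ring.
  by lia.
(* The sign of [m] separates the two families: [m = - a - 1] turns [48 m^2 + 30 m + 5] into
   [48 a^2 + 66 a + 23]. *)
have [a [ma|ma]] : exists a : nat, m = a%:Z \/ m = - a%:Z - 1.
  by case: (m) => a; exists a; lia.
  exists a; left; split; first by rewrite sE ma.
  by rewrite -mulnn; move: e; rewrite ma; lia.
exists a; right; split; first by rewrite sE ma; ring.
rewrite -mulnn; have : p%:Z = 48 * (a%:Z * a%:Z) + 66 * a%:Z + 23 by rewrite e ma; ring.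
by lia.
Qed.

(** Each family allows two values of [k], because [k] may be either of the two nontrivial
    subdegrees. *)
Lemma eigenvalue_arith (p k : nat) (r s : int) :
  odd p -> (0 < k)%N -> (k < 3 * p - 1)%N ->
  k%:Z + p%:Z * r + (2 * p%:Z - 1) * s = 0 ->
  k%:Z ^+ 2 + p%:Z * r ^+ 2 + (2 * p%:Z - 1) * s ^+ 2 = 3 * p%:Z * k%:Z ->
  exists a : nat,
    (p = 48 * a ^ 2 + 30 * a + 5 /\ (k = p + 4 * a + 1 \/ k = 2 * p - 4 * a - 2))%N
    \/
    (p = 48 * a ^ 2 + 66 * a + 23 /\ (k = p - 4 * a - 3 \/ k = 2 * p + 4 * a + 2))%N.
Proof.
move=> podd k0 kn e1 e2.
have p0 : (0 < p)%N by case: (p) podd.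
pose t : int := - (r + 2 * s).
have rE : r = - 2 * s - t by rewrite /t; ring.
have kE : k%:Z = s + p%:Z * t.
  by apply: subr0_eq; rewrite -e1 /t; ring.
have key : 6 * s ^+ 2 + 6 * s * t + t ^+ 2 - 3 * s = p%:Z * t * (3 - t).
  have pZ0 : p%:Z != 0 by lia.
  apply: (mulfI pZ0); apply: subr0_eq; move/eqP: e2; rewrite -subr_eq0 => /eqP <-.
  by rewrite kE rE; ring.
(* This is 24 times [key] with the square in [s] completed. *)
have sqr : (12 * s + 6 * t - 3) ^+ 2 = 9 + t * (3 - t) * (24 * p%:Z - 12).
  rewrite (_ : 9 + _ = 24 * (p%:Z * t * (3 - t)) + 9 + 12 * t ^+ 2 - 36 * t); last by ring.
  by rewrite -key; ring.
clearbody t.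
(* As [24 p - 12 >= 12], a nonnegative square excludes [t (3 - t) <= -4], which holds for every
   integer [t] outside 0..3. *)
have t03 : t = 0 \/ t = 1 \/ t = 2 \/ t = 3.
  suff : 0 <= t /\ t <= 3 by lia.
  have sq0 : 0 <= (12 * s + 6 * t - 3) ^+ 2 by apply: Num.Theory.sqr_ge0.
  have {sqr sq0} : 0 <= 9 + t * (3 - t) * (24 * p%:Z - 12) by rewrite -sqr.
  have q12 : 12 <= 24 * p%:Z - 12 by lia.
  move: (24 * p%:Z - 12) q12 => q q12 h.
  have {h} : - 3 <= t * (3 - t).
    by move: (t * (3 - t)) h => w h; clear -h q12; nia.
  by clear; nia.
(* To be used with [s1 = s] for [t = 1], and for [t = 2] with [s1 = - 1 - s], the eigenvalue of the
   complementary orbital. *)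
have solve s1 : 2 * p%:Z = 6 * s1 ^+ 2 + 3 * s1 + 1 ->
    k%:Z = s1 + p%:Z \/ k%:Z = - 1 - s1 + 2 * p%:Z -> exists a : nat,
    (p = 48 * a ^ 2 + 30 * a + 5 /\ (k = p + 4 * a + 1 \/ k = 2 * p - 4 * a - 2))%N
    \/
    (p = 48 * a ^ 2 + 66 * a + 23 /\ (k = p - 4 * a - 3 \/ k = 2 * p + 4 * a + 2))%N.
  move=> /(odd_quadratic_value podd)[a] [] [sE pE] kE'; exists a; [left|right].
    by split=> //; clear -kE' sE; lia.
  by split=> //; clear -kE' sE; lia.
(* [t = 0] gives [s = 0] and [k = 0]; [t = 3] gives [s = - 1] and [k = 3 p - 1]. The other root is a
   half-integer in both cases. *)
case: t03 => [t0|[t1|[t2|t3]]].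
- have : s * (2 * s - 1) = 0 by rewrite t0 in key; clear -key; nia.
  by move/eqP; rewrite mulf_eq0 => /orP[] /eqP; rewrite t0 in kE; clear -kE k0; lia.
- apply: (solve s); last by left; rewrite kE t1 mulr1.
  by move: key; rewrite t1; clear; lia.
- apply: (solve (- 1 - s)); last by right; rewrite kE t2; ring.
  rewrite (_ : 6 * _ + _ + _ = 6 * s ^+ 2 + 9 * s + 4); last by ring.
  by move: key; rewrite t2; clear; lia.
- have : (s + 1) * (2 * s + 3) = 0 by rewrite t3 in key; clear -key; nia.
  by move/eqP; rewrite mulf_eq0 => /orP[] /eqP; rewrite t3 in kE; clear -kE kn p0; lia.
Qed.
End Arithmetic.

(** * Idempotent kernels of the irreducible characters *)

Section Spectral.
Import Order.TTheory GRing.Theory Num.Theory.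
Local Open Scope ring_scope.

Variables (T : finType) (G : {group {perm T}}).
Implicit Types (x y z : T) (g h : {perm T}) (i j : Iirr G).

(** Double count of the pairs [(x, g)] with [g x = x], weighted by [phi g]. *)
Lemma sum_cfun_fix (phi : 'CF(G)) :
  \sum_x \sum_(g in G | g x == x) phi g = \sum_(g in G) perm_char G g * phi g.
Proof.
under eq_bigr do rewrite big_mkcondr.
rewrite exchange_big; apply: eq_bigr => g Gg.
rewrite perm_charE // -sum1_card natr_sum mulr_suml.
rewrite -big_mkcond; apply: eq_big => x; last by rewrite mul1r.
by apply/eqP/afix1P.
Qed.

(* The entries of the group-algebra idempotent of 'chi_i acting on functions on T. *)
Definition isotypic_kernel i x y : algC :=
  'chi_i 1%g / #|G|%:R * \sum_(g in G | g x == y) 'chi_i g^-1%g.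
Local Notation E := isotypic_kernel.

Lemma isotypic_kernel_invariant i g x y : g \in G -> E i (g x) (g y) = E i x y.
Proof.
move=> Gg; congr (_ * _).
rewrite (reindex_inj (conjg_inj g)); apply: eq_big => h.
  by rewrite groupJr // permJ (inj_eq perm_inj).
by case/andP => Gh _; rewrite -conjVg cfunJ.
Qed.

(** Composing kernels convolves the characters, so this is the generalized orthogonality
    relation. *)
Lemma isotypic_kernel_mul i j x y :
  \sum_z E i x z * E j z y = E i x y *+ (i == j).
Proof.
pose c k : algC := 'chi[G]_k 1%g / #|G|%:R.
have -> : \sum_z E i x z * E j z y = c i * c j * \sum_(m in G | m x == y)
    \sum_(g in G) 'chi_j (g * m^-1)%g * 'chi_i g^-1%g.
  transitivity (c i * c j * \sum_(g in G) \sum_(h in G | h (g x) == y)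
                   'chi_i g^-1%g * 'chi_j h^-1%g).
    transitivity (\sum_z \sum_(g in G | g x == z) c i * c j *
       \sum_(h in G | h z == y) 'chi_i g^-1%g * 'chi_j h^-1%g).
      apply: eq_bigr => z _; rewrite /E -/(c i) -/(c j) mulrACA -mulr_sumr.
      by congr (_ * _); rewrite mulr_suml; apply: eq_bigr => g _; rewrite mulr_sumr.
    under eq_bigr do rewrite big_mkcondr.
    rewrite exchange_big mulr_sumr; apply: eq_bigr => g Gg /=.
    by rewrite -big_mkcond (big_pred1 (g x)) // => z; rewrite eq_sym.
  (* Substituting [h = g^-1 m] makes the product [m = g h] the outer variable; [m^-1 g] is conjugate
     to [g m^-1]. *)
  congr (_ * _); rewrite [RHS]exchange_big; apply: eq_bigr => g Gg.
  rewrite (reindex_inj (mulgI g^-1%g)); apply: eq_big => m.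
    by rewrite groupMl ?groupV // permM permK.
  by rewrite invMg invgK mulrC -{1}(cfunJ 'chi_j (m^-1 * g)%g (groupVr Gg)) conjgE invgK mulgK.
rewrite /E -/(c i).
transitivity (c i * c j * \sum_(m in G | m x == y)
                #|G|%:R * ((j == i)%:R * ('chi_j m^-1%g / 'chi_j 1%g))).
  congr (_ * _); apply: eq_bigr => m _.
  by rewrite -generalized_orthogonality_relation mulVKf ?neq0CG.
have [->|_] := eqVneq i j; last first.
  by rewrite big1 ?mulr0 // => m _; rewrite mul0r mulr0.
rewrite mulr1n -mulrA; congr (_ * _); rewrite mulr_sumr; apply: eq_bigr => m _.
rewrite mul1r /c; field; by rewrite irr1_neq0 neq0CG.
Qed.

(** * Multiplicity-free permutation characters *)

Variables (S : {set Iirr G}).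
Hypothesis charS : perm_char G = \sum_(i in S) 'chi_i.

(** The trace is the degree times the multiplicity ['[perm_char G, 'chi_i]], which is 1 for [i] in
    [S]. *)
Lemma isotypic_kernel_trace i : i \in S -> \sum_x E i x x = 'chi_i 1%g.
Proof.
move=> Si; rewrite -mulr_sumr.
transitivity ('chi_i 1%g * '[perm_char G, 'chi_i]); last first.
  rewrite charS cfdot_suml (bigD1 i) //= cfnorm_irr big1 ?addr0 ?mulr1 // => j.
  by case/andP=> _ /negbTE ji; rewrite cfdot_irr ji.
rewrite -mulrA; congr (_ * _); rewrite cfdotE; congr (_ * _).
transitivity (\sum_x \sum_(g in G | g x == x) (('chi_i)^*)%CF g).
  by apply: eq_bigr => x _; apply: eq_bigr => g _; rewrite cfunE irr_inv.
by rewrite sum_cfun_fix; apply: eq_bigr => g _; rewrite [X in _ * X]cfunE.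
Qed.

(** Thus the coefficient [c j] is the eigenvalue of the combination on the image of [E j]. *)
Lemma isotypic_kernel_comb_mul (c : Iirr G -> algC) j x y : j \in S ->
  \sum_z (\sum_(i in S) c i * E i x z) * E j z y = c j * E j x y.
Proof.
move=> Sj.
transitivity (\sum_(i in S) c i * (E i x y *+ (i == j))).
  under eq_bigr do rewrite mulr_suml.
  rewrite exchange_big; apply: eq_bigr => i _.
  by rewrite -isotypic_kernel_mul mulr_sumr; apply: eq_bigr => z _; rewrite mulrA.
rewrite (bigD1 j) //= eqxx mulr1n big1 ?addr0 // => i /andP[_ /negbTE->].
by rewrite mulr0n mulr0.
Qed.

Lemma isotypic_kernel_comb_mul2 (c d : Iirr G -> algC) x y :
  \sum_z (\sum_(i in S) c i * E i x z) * (\sum_(j in S) d j * E j z y) =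
  \sum_(j in S) c j * d j * E j x y.
Proof.
under eq_bigr do rewrite mulr_sumr.
rewrite exchange_big; apply: eq_bigr => j Sj.
rewrite mulrAC -isotypic_kernel_comb_mul // mulr_suml.
by apply: eq_bigr => z _; rewrite mulrCA mulrC.
Qed.

Lemma isotypic_kernel_comb_trace (c : Iirr G -> algC) :
  \sum_x \sum_(i in S) c i * E i x x = \sum_(i in S) c i * 'chi_i 1%g.
Proof.
rewrite exchange_big; apply: eq_bigr => i Si.
by rewrite -mulr_sumr isotypic_kernel_trace.
Qed.

(** Composing with [E j] and taking the trace isolates [c j] times the nonzero degree of
    ['chi_j]. *)
Lemma isotypic_kernel_inj (c d : Iirr G -> algC) :
  (forall x y, \sum_(i in S) c i * E i x y = \sum_(i in S) d i * E i x y) ->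
  {in S, c =1 d}.
Proof.
move=> cd j Sj; apply: (mulIf (irr1_neq0 j)).
rewrite -(isotypic_kernel_trace Sj) !mulr_sumr; apply: eq_bigr => x _.
rewrite -!isotypic_kernel_comb_mul //; apply: eq_bigr => z _.
by rewrite cd.
Qed.

(** * Invariant kernels of a transitive group *)

Hypothesis transG : [transitive G, on [set: T] | 'P].

Lemma transG_ex x y : exists2 g, g \in G & g x = y.
Proof.
have := in_setT y; rewrite -(atransP transG x (in_setT x)) => /imsetP[g Gg ->].
by exists g.
Qed.

(* Both sides equal |G|^-1 \sum_g |Fix g|^2. *)
Lemma card_suborbits x : #|suborbits G x| = #|S|.
Proof.
have normS : '[perm_char G] = #|S|%:R.
  rewrite {1}charS cfdot_suml -sum1_card natr_sum; apply: eq_bigr => i Si.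
  rewrite charS cfdot_sumr (bigD1 i) //= cfnorm_irr big1 ?addr0 // => j.
  by case/andP=> _ /negbTE ji; rewrite cfdot_irr eq_sym ji.
(* Frobenius-Cauchy for the stabiliser of [y]; by transitivity its number of orbits is the same as
   at [x]. *)
have stab y : \sum_(g in G | g y == y) perm_char G g =
    (#|suborbits G x| * #|'C_G[y | 'P]%g|)%:R.
  have [h Gh <-] := transG_ex x y.
  rewrite -(card_imset _ (imset_inj (@perm_inj _ h))) -suborbits_perm //.
  have actsC : [acts 'C_G[h x | 'P]%g, on [set: T] | 'P].
    by apply/actsP => g _ z; rewrite !inE.
  have -> : suborbits G (h x) = [set orbit 'P ('C_G[h x | 'P])%g z | z in [set: T]].
    by apply/setP => B; apply/imsetP/imsetP => -[z _ ->]; exists z.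
  rewrite -(Frobenius_Cauchy actsC) natr_sum; apply: eq_big => [g|g /andP[Gg _]].
    by rewrite inE; congr (_ && _); apply/eqP/astab1P.
  by rewrite perm_charE // setTI.
have orb y : (#|'C_G[y | 'P]%g| * #|T| = #|G|)%N.
  by rewrite -(card_orbit_stab 'P G y) (atransP transG) ?inE // cardsT mulnC.
apply/eqP; rewrite -(eqr_nat algC) -normS cfdotE; apply/eqP.
transitivity (#|G|%:R^-1 * (\sum_y \sum_(g in G | g y == y) perm_char G g)).
  under eq_bigr do rewrite stab natrM.
  rewrite -mulr_sumr mulrCA -natr_sum.
  rewrite (_ : (\sum_y _)%N = #|G|) ?mulVf ?mulr1 ?neq0CG //.
  have T0 : (0 < #|T|)%N by apply/card_gt0P; exists x.
  apply/eqP; rewrite -(eqn_pmul2r T0) big_distrl /=.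
  by under eq_bigr do rewrite orb; rewrite sum_nat_const mulnC.
rewrite sum_cfun_fix; congr (_ * _); apply: eq_bigr => g Gg.
by rewrite perm_charE // conjC_nat.
Qed.

Definition invariant2 (f : T -> T -> algC) :=
  forall g x y, g \in G -> f (g x) (g y) = f x y.

Lemma invariant2_eq x0 (e f : T -> T -> algC) : invariant2 e -> invariant2 f ->
  e x0 =1 f x0 -> forall x y, e x y = f x y.
Proof.
move=> ie jf ef x y; have [g Gg <-] := transG_ex x0 x.
by rewrite -[y](permKV g) ie // jf.
Qed.

Lemma invariant2_suborbit x (f : T -> T -> algC) y z : invariant2 f ->
  z \in orbit 'P ('C_G[x | 'P])%g y -> f x z = f x y.
Proof. by move=> jf /mem_suborbit[h Gh [hx <-]]; rewrite -{1}hx jf. Qed.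

(** Dimension count: an invariant function is determined by its values at one representative of each
    suborbit of [x0], and there are as many independent kernels as suborbits. *)
Lemma invariant2_span (f : T -> T -> algC) : invariant2 f ->
  exists c : Iirr G -> algC, forall x y, f x y = \sum_(i in S) c i * E i x y.
Proof.
move=> invf; have [/pred0P T0|/pred0Pn[x0 _]] := boolP (pred0b T).
  by exists (fun=> 0) => x; have := T0 x; rewrite !inE.
pose X := suborbits G x0.
have Xpt (k : 'I_#|X|) : {y | enum_val k = orbit 'P ('C_G[x0 | 'P])%g y}.
  by apply: sig_eqW; have /imsetP[y _ ->] := enum_valP k; exists y.
pose pt k := sval (Xpt k).
have inv_eq (e f' : T -> T -> algC) : invariant2 e -> invariant2 f' ->
    (forall k, e x0 (pt k) = f' x0 (pt k)) -> forall x y, e x y = f' x y.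
  move=> ie jf ek; apply: (@invariant2_eq x0) => // w.
  have Xw : orbit 'P ('C_G[x0 | 'P])%g w \in X by apply: imset_f.
  pose k := enum_rank_in Xw (orbit 'P ('C_G[x0 | 'P])%g w).
  have wk : w \in orbit 'P ('C_G[x0 | 'P])%g (pt k).
    by rewrite -(svalP (Xpt k)) enum_rankK_in //; apply: orbit_refl.
  by rewrite (invariant2_suborbit ie wk) (invariant2_suborbit jf wk).
pose Q := \matrix_(l < #|S|, k < #|X|) E (enum_val l) x0 (pt k).
pose comb (w : 'rV[algC]_#|S|) x y := \sum_l w 0 l * E (enum_val l) x y.
have inv_comb w : invariant2 (comb w).
  by move=> g x y Gg; apply: eq_bigr => l _; rewrite isotypic_kernel_invariant.
have combQ w k : comb w x0 (pt k) = (w *m Q) 0 k.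
  by rewrite mxE; apply: eq_bigr => l _; rewrite mxE.
(* The sum has one term for [i] in [S] and none otherwise, so [cf w] extends the coefficients by
   0. *)
pose cf (w : 'rV[algC]_#|S|) (i : Iirr G) : algC := 
   \sum_(l | enum_val l == i) w 0 l.
have cfE w l : cf w (enum_val l) = w 0 l.
  by rewrite /cf (big_pred1 l) // => k; rewrite (inj_eq enum_val_inj).
have combE w x y : comb w x y = \sum_(i in S) cf w i * E i x y.
  by rewrite big_enum_val; apply: eq_bigr => l _; rewrite cfE.
(* Independence of the kernels makes the rows of [Q] independent, and [Q] has as many rows as
   columns. *)
have fullQ : row_full Q.
  have /eqP rQ : row_free Q.
    apply: inj_row_free => w wQ; apply/rowP => l; rewrite mxE -cfE.
    apply: (@isotypic_kernel_inj (cf w) (fun=> 0)); last exact: enum_valP.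
    move=> x y; rewrite -combE [RHS]big1 => [|i _]; last by rewrite mul0r.
    apply: (inv_eq (comb w) (fun _ _ => 0)) => // k.
    by rewrite combQ wQ mxE.
  by rewrite /row_full rQ /X card_suborbits.
pose v := \row_(k < #|X|) f x0 (pt k).
have /submxP[w vw] : (v <= Q)%MS by apply: submx_full.
exists (cf w) => x y; rewrite -combE; apply: inv_eq => // k.
by rewrite combQ -vw mxE.
Qed.

(** The identity is invariant, hence a combination of kernels; composing it with [E i] gives
    [c i * E i = E i]. *)
Lemma isotypic_kernel_sum x y : \sum_(i in S) E i x y = (x == y)%:R.
Proof.
have invI : invariant2 (fun x y => (x == y)%:R).
  by move=> g u v _; rewrite (inj_eq perm_inj).
have [c cE] := invariant2_span invI.
rewrite cE; apply: eq_bigr => i Si; rewrite -isotypic_kernel_comb_mul //.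
under eq_bigr do rewrite -cE mulr_natl mulrb.
by rewrite -big_mkcond (big_pred1 x) // => z; rewrite eq_sym.
Qed.

(** Transitivity makes this kernel constant, and its trace 1 fixes the constant. *)
Lemma isotypic_kernel0 x y : 0 \in S -> E 0 x y = #|T|%:R^-1.
Proof.
move=> S0; have E0c u v : E 0 u v = E 0 x y.
  have [h Gh <-] := transG_ex u x; have [g Gg <-] := transG_ex (h v) y.
  rewrite -(isotypic_kernel_invariant 0 u v Gh); congr (_ * _).
  rewrite [RHS](reindex_inj (mulIg g)); apply: eq_big => m.
    by rewrite groupMr // permM (inj_eq perm_inj).
  by case/andP=> Gm _; rewrite irr0 !cfun1E ?groupV ?groupM // Gm.
have := isotypic_kernel_trace S0; under eq_bigr do rewrite E0c.
rewrite sumr_const irr0 cfun11 => Exy.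
have T0 : #|T|%:R != 0 :> algC by rewrite pnatr_eq0 -lt0n; apply/card_gt0P; exists x.
by apply: (mulIf T0); rewrite mulr_natr Exy mulVf.
Qed.

End Spectral.

(** * Roots of integral monic quadratics *)

Section Algebraics.
Import Order.TTheory GRing.Theory Num.Theory.
Local Open Scope ring_scope.

Lemma monic_quadratic_Aint (a b c : algC) :
  a \is a Num.int -> b \is a Num.int -> c ^+ 2 = a + b * c -> c \in Aint.
Proof.
move=> Za Zb cE; apply: (@root_monic_Aint ('X^2 - (b *: 'X + a%:P))).
- by rewrite /root !hornerE cE; apply/eqP; ring.
- have sz : (size (- (b *: 'X + a%:P)) < size ('X^2 : {poly algC}))%N.
    rewrite size_polyN size_polyXn (leq_ltn_trans (size_polyD _ _)) // gtn_max.
    rewrite (leq_ltn_trans (size_scale_leq _ _)) ?size_polyX //=.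
    by rewrite (leq_ltn_trans (size_polyC_leq1 _)).
  by rewrite monicE lead_coefDl // lead_coefXn.
apply/polyOverP => m; rewrite coefB coefXn coefD coefZ coefX coefC.
have Za0 : (if m == 0 then a else 0) \is a Num.int by case: eqP.
by rewrite rpredB ?rpredD ?rpredM ?natr_int.
Qed.
End Algebraics.

(** * Eigenvalues of an orbital in rank three *)

Section RankThree.
Import Order.TTheory GRing.Theory Num.Theory.
Local Open Scope ring_scope.

Variables (T : finType) (G : {group {perm T}}) (i j : Iirr G).
Hypothesis transG : [transitive G, on [set: T] | 'P].
Hypotheses (i0 : i != 0) (j0 : j != 0) (ij : i != j).
Hypothesis charG : perm_char G = 1 + 'chi_i + 'chi_j.
Local Notation E := (@isotypic_kernel T G).

Let S : {set Iirr G} := 0 |: (i |: [set j]).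

Lemma rank3_sum (M : nmodType) (F : Iirr G -> M) :
  \sum_(l in S) F l = F 0 + F i + F j.
Proof.
have i_j : i \notin [set j] by rewrite inE.
have z_ij : 0 \notin i |: [set j] by rewrite !inE negb_or ![0 == _]eq_sym i0.
by rewrite /S big_setU1 // big_setU1 // big_set1; apply: addrA.
Qed.

Lemma rank3_char : perm_char G = \sum_(l in S) 'chi_l.
Proof. by rewrite rank3_sum irr0. Qed.

(** Three constituents give three suborbits; besides [[set x]] and that of [d], exactly one is
    left. *)
Lemma rank3_suborbits x d : d != x -> exists2 e, e != x &
  let B := orbit 'P ('C_G[x | 'P])%g d in let C := orbit 'P ('C_G[x | 'P])%g e in
  perm_eq (enum (suborbits G x)) [:: [set x]; B; C].
Proof.
move=> dx; set B := orbit _ _ _.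
have Bd : d \in B by apply: orbit_refl.
have sz : size (enum (suborbits G x)) = 3.
  rewrite -cardE (card_suborbits rank3_char transG) /S !cardsU1 cards1 !inE negb_or.
  by rewrite ![0 == _]eq_sym i0 j0 ij.
have xS : [set x] \in enum (suborbits G x).
  by rewrite mem_enum -(suborbit_self G); apply: imset_f.
have BS : B \in rem [set x] (enum (suborbits G x)).
  rewrite mem_rem_uniq ?enum_uniq // inE mem_enum imset_f // andbT.
  by apply: contra dx => /eqP Bx; rewrite Bx inE in Bd.
have sP : perm_eq (enum (suborbits G x))
    [:: [set x], B & rem B (rem [set x] (enum (suborbits G x)))].
  by rewrite (perm_trans (perm_to_rem xS)) // perm_cons; apply: perm_to_rem.
have uS := perm_uniq sP; rewrite enum_uniq in uS.
have mS := perm_mem sP.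
have := perm_size sP; rewrite sz.
case: (rem B _) sP uS mS => [|C [|]] //= sP uS mS _.
have : C \in suborbits G x by rewrite -mem_enum mS !inE eqxx !orbT.
case/imsetP=> e _ CE; exists e; last by rewrite -CE.
apply/eqP=> ex; move: uS; rewrite CE ex suborbit_self !inE.
by rewrite eqxx orbT.
Qed.

Lemma rank3_eigenvalues x d : d != x -> 'chi_i 1%g != 'chi_j 1%g ->
  let k : int := #|orbit 'P ('C_G[x | 'P])%g d|%:Z in
  exists r s : int,
    k%:~R + 'chi_i 1%g * r%:~R + 'chi_j 1%g * s%:~R = 0 /\
    k%:~R ^+ 2 + 'chi_i 1%g * r%:~R ^+ 2 + 'chi_j 1%g * s%:~R ^+ 2 = #|T|%:R * k%:~R.
Proof.
move=> dx degij k.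
have [e ex /= SO] := rank3_suborbits dx.
pose B := orbit 'P ('C_G[x | 'P])%g d; pose C := orbit 'P ('C_G[x | 'P])%g e.
rewrite -/B -/C in k SO *.
have charS := rank3_char.
have [S0 Si Sj] : [/\ 0 \in S, i \in S & j \in S] by rewrite !inE !eqxx !orbT.
(* [A] is the orbital of [(x, d)]. Below, [f] is its adjacency matrix, [c] lists the eigenvalues,
   and [P] counts paths of length two, the entries of the square. *)
pose A y z := [exists g in G, (g x == y) && (g d == z)].
have AP y z : reflect (exists2 g, g \in G & g x = y /\ g d = z) (A y z).
  apply: (iffP existsP) => [[g /andP[Gg /andP[/eqP ? /eqP ?]]]|[g Gg [<- <-]]].
    by exists g.
  by exists g; rewrite Gg !eqxx.
have Ax y : A x y = (y \in B) by apply/AP/mem_suborbit.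
have invA g y z : g \in G -> A (g y) (g z) = A y z.
  move=> Gg; apply/AP/AP => -[h Gh [hx hd]].
    exists (h * g^-1)%g; first by rewrite groupM ?groupV.
    by rewrite !permM hx hd !permK.
  by exists (h * g)%g; rewrite ?groupM // !permM hx hd.
pose f y z : algC := (A y z)%:R.
have invf : invariant2 G f by move=> g y z Gg; rewrite /f invA.
have [c cE] := invariant2_span charS transG invf.
pose P y z : nat := (\sum_w A y w * A w z)%N.
have invP : invariant2 G (fun y z => (P y z)%:R).
  move=> g y z Gg; congr (_%:R); rewrite /P (reindex_inj (@perm_inj _ g)).
  by apply: eq_bigr => w _; rewrite !invA.
have Bd : d \in B by apply: orbit_refl.
have Ce : e \in C by apply: orbit_refl.
have cover y : [|| y == x, y \in B | y \in C].
  have : y \in cover (suborbits G x).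
    by rewrite (cover_partition (suborbits_partition G x)) inE.
  case/bigcupP => D DS yD.
  have : D \in enum (suborbits G x) by rewrite mem_enum.
  rewrite (perm_mem SO) !inE => /or3P[] /eqP DE; rewrite DE in yD.
  - by move: yD; rewrite inE => ->.
  - by rewrite yD orbT.
  - by rewrite yD !orbT.
have uSO : uniq [:: [set x]; B; C] by rewrite -(perm_uniq SO) enum_uniq.
have BC : B != C by move: uSO; rewrite /= !inE negb_or -andbA => /and4P[].
have eB : e \notin B by apply: contra BC => /orbit_eqP eB; rewrite /C eB.
have f_e : f x e = 0 by rewrite /f Ax (negbTE eB).
have f_d : f x d = 1 by rewrite /f Ax Bd.
have f_x : f x x = 0.
  rewrite /f Ax; case: mem_suborbit => // -[h _ [hx hd]].
  by move: dx; rewrite -(inj_eq (@perm_inj _ h)) hx hd eqxx.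
pose X := P x x; pose Y := P x d; pose Z := P x e.
pose n : algC := #|T|%:R.
have n0 : n != 0 by rewrite pnatr_eq0 -lt0n; apply/card_gt0P; exists x.
have E0 y z : E 0 y z = n^-1 by rewrite (isotypic_kernel0 charS transG).
(* A^2 = X I + Y A + Z (J - I - A) *)
pose q l : algC := X%:R + Y%:R * c l + Z%:R * (n *+ (l == 0) - 1 - c l).
have qE y z : (P y z)%:R = \sum_(l in S) q l * E l y z.
  apply: (invariant2_eq transG (x0 := x) invP
    (f := fun y z => \sum_(l in S) q l * E l y z)) => [g u v Gg|{}z] /=.
    by apply: eq_bigr => l _; rewrite isotypic_kernel_invariant.
  have -> : \sum_(l in S) q l * E l x z =
      X%:R * (x == z)%:R + Y%:R * f x z + Z%:R * (1 - (x == z)%:R - f x z).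
    (* The all-ones matrix is [n] times the kernel of the trivial character. *)
    have J1 : 1 = \sum_(l in S) (n *+ (l == 0)) * E l x z.
      by rewrite rank3_sum eqxx (negbTE i0) (negbTE j0) !mulr0n !mul0r !addr0 E0 mulfV.
    rewrite cE -(isotypic_kernel_sum charS transG) [X in X - _ - _]J1.
    rewrite -!sumrB !mulr_sumr -!big_split; apply: eq_bigr => l _ /=.
    by rewrite /q; move: (n *+ _) => m; ring.
  case/or3P: (cover z) => [/eqP->|zB|zC].
  - by rewrite eqxx f_x mulr1n -/X; ring.
  - rewrite (invariant2_suborbit invP zB) (invariant2_suborbit invf zB) f_d.
    rewrite (_ : x == z = false) ?mulr0n -/Y; first by ring.
    apply/eqP => xz; move: f_x; rewrite {2}xz (invariant2_suborbit invf zB) f_d.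
    by move/eqP; rewrite oner_eq0.
  - rewrite (invariant2_suborbit invP zC) (invariant2_suborbit invf zC) f_e.
    rewrite (_ : x == z = false) ?mulr0n -/Z; first by ring.
    apply/eqP => xz; move: zC; rewrite -xz => /orbit_eqP xC.
    by move: uSO; rewrite /= -(suborbit_self G x) xC -/C !inE eqxx !orbT.
(* Both sides are coefficients of the square of [f], and the kernels are independent. *)
have sqE l : l \in S -> c l ^+ 2 = q l.
  move: l; apply: (isotypic_kernel_inj charS) => y z; rewrite -qE.
  have -> : (P y z)%:R = \sum_w f y w * f w z :> algC.
    by rewrite natr_sum; apply: eq_bigr => w _; rewrite natrM.
  under [RHS]eq_bigr do rewrite !cE.
  by rewrite isotypic_kernel_comb_mul2; apply: eq_bigr => l _; rewrite expr2.
have c0 : c 0 = k%:~R.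
  apply: (mulIf (invr_neq0 n0)); rewrite -(E0 x x) -(isotypic_kernel_comb_mul c x x S0).
  under eq_bigr do rewrite -cE E0 /f Ax.
  rewrite -mulr_suml -natr_sum /k -pmulrn; rewrite (E0 x x); congr (_%:R * _).
  by rewrite -sum1_card [RHS]big_mkcond; apply: eq_bigr => y _; case: (y \in B).
(* The orbital is nontrivial, so [f] vanishes on the diagonal. *)
have tr1 : k%:~R + 'chi_i 1%g * c i + 'chi_j 1%g * c j = 0.
  have := isotypic_kernel_comb_trace charS c; rewrite rank3_sum c0 irr0 cfun11 mulr1.
  rewrite ![_ * 'chi__ _]mulrC => <-; apply: big1 => y _; rewrite -cE.
  have [g Gg <-] := transG_ex transG x y; by rewrite invf.
have tr2 : k%:~R ^+ 2 + 'chi_i 1%g * c i ^+ 2 + 'chi_j 1%g * c j ^+ 2 = n * X%:R.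
  have := isotypic_kernel_comb_trace charS q.
  rewrite rank3_sum -!sqE // c0 irr0 cfun11 mulr1 ![_ * 'chi__ _]mulrC => <-.
  under eq_bigr do rewrite -qE.
  transitivity (\sum_(y : T) X%:R : algC); last by rewrite sumr_const mulr_natl.
  by apply: eq_bigr => y _; have [g Gg <-] := transG_ex transG x y; rewrite invP.
(* Equal eigenvalues would make [f] constant off the diagonal, against [f_d] and [f_e]. *)
have cij : c i != c j.
  apply/eqP => cij.
  have fE y : y != x -> f x y = (c 0 - c i) / n.
    move=> yx; have := isotypic_kernel_sum charS transG x y.
    rewrite eq_sym (negbTE yx) mulr0n rank3_sum => E1.
    rewrite cE rank3_sum -cij -(E0 x y).
    by apply: subr0_eq; rewrite -(mulr0 (c i)) -E1; ring.
  by move: f_d f_e; rewrite !fE // => -> /eqP; rewrite oner_eq0.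
have qi : c i ^+ 2 = X%:R + Y%:R * c i + Z%:R * (- 1 - c i).
  by rewrite sqE // /q (negbTE i0) mulr0n sub0r.
have qj : c j ^+ 2 = X%:R + Y%:R * c j + Z%:R * (- 1 - c j).
  by rewrite sqE // /q (negbTE j0) mulr0n sub0r.
have cD : c i + c j = Y%:R - Z%:R.
  have : c i - c j != 0 by rewrite subr_eq0.
  move/mulfI; apply; rewrite -subr_sqr qi qj; ring.
have Aint_c l : c l ^+ 2 = X%:R + Y%:R * c l + Z%:R * (- 1 - c l) -> c l \in Aint.
  move=> ql; apply: (@monic_quadratic_Aint (X%:R - Z%:R) (Y%:R - Z%:R)).
  - by rewrite rpredB ?natr_int.
  - by rewrite rpredB ?natr_int.
  - by rewrite ql; ring.
(* [cD] and [tr1] form a rational linear system in [c i] and [c j], solvable because the degrees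
   differ. *)
have rat_j : c j \in Crat.
  have : ('chi_j 1%g - 'chi_i 1%g) * c j = - k%:~R - 'chi_i 1%g * (Y%:R - Z%:R).
    by rewrite -cD; apply: subr0_eq; rewrite -tr1; ring.
  rewrite !irr1_degree in degij *; rewrite eq_sym -subr_eq0 in degij.
  move/(canRL (mulKf degij)) ->.
  by rewrite rpredM ?rpredV ?rpredB ?rpredN ?rpredM ?rpredB ?rpred_nat ?rpred_int.
have rat_i : c i \in Crat.
  by rewrite -[c i](addrK (c j)) cD rpredB ?rpredB ?rpred_nat.
have /intrP[r rE] := Cint_rat_Aint rat_i (Aint_c _ qi).
have /intrP[s sE] := Cint_rat_Aint rat_j (Aint_c _ qj).
exists r, s; rewrite -rE -sE; split=> //; rewrite tr2 /n; congr (_ * _).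
(* Either all arcs from [x] are reversible or none is, so [X] is [#|B|] or 0. *)
have Adx w : w \in B -> A w x = A d x.
  by case/mem_suborbit=> h Gh [hx <-]; rewrite -{1}hx invA.
have XE : X = (A d x * #|B|)%N.
  rewrite /X /P -sum1_card big_distrr [RHS]big_mkcond; apply: eq_bigr => w _.
  by rewrite Ax; case: (boolP (w \in B)) => [/Adx->|//]; apply: mulnC.
(* In the non-symmetric case [X = 0], and [tr2] equates a sum of nonnegative terms with 0 although
   [k > 0]. *)
rewrite XE; case: (A d x) XE => XE; first by rewrite mul1n.
have k0 : k%:~R != 0 :> algC.
  by rewrite intr_eq0 eqz_nat -lt0n; apply/card_gt0P; exists d.
case/eqP: k0; apply/eqP; rewrite -sqrf_eq0.
move/eqP: tr2; rewrite XE mulr0 -addrA paddr_eq0; first by case/andP.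
  by rewrite -rmorphXn ler0z sqr_ge0.
by rewrite addr_ge0 // mulr_ge0 ?(ltW (irr1_gt0 _)) // ?rE ?sE -rmorphXn ler0z sqr_ge0.
Qed.

End RankThree.

(** * Subdegrees of a Type II group *)

Theorem theorem8p1 (T : finType) (p : nat) (G : {group {perm T}}) :
  prime p -> 5 <= p -> #|T| = 3 * p ->
  [primitive G, on [set: T] | 'P] ->
  ~~ [transitive^2 G, on [set: T] | 'P] ->
  typeII p G ->
  exists a : nat,
    (p = 48 * a ^ 2 + 30 * a + 5 /\
     forall x : T, perm_eq (subdegrees G x)
       [:: 1; p + 4 * a + 1; 2 * p - 4 * a - 2])
    \/
    (p = 48 * a ^ 2 + 66 * a + 23 /\
     forall x : T, perm_eq (subdegrees G x)
       [:: 1; p - 4 * a - 3; 2 * p + 4 * a + 2]).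
Proof.
move=> pr_p p5 cardT primG _ [i [j [ij charG degi degj]]].
have transG : [transitive G, on [set: T] | 'P] by case/andP: primG.
have podd : odd p by case: (even_prime pr_p) => // pE; rewrite pE in p5.
(* The trivial character has degree 1, so neither constituent is trivial. *)
have deg0 (l : Iirr G) n : ('chi_l 1%g = n%:R)%R -> 1 < n -> l != 0%R.
  move=> degl n1; apply: contraTneq n1 => l0; move: degl.
  rewrite l0 irr0 cfun11 => /eqP; rewrite -[1%R]/(1%:R)%R Num.Theory.eqr_nat => /eqP <-.
  by [].
have i0 := deg0 _ _ degi (ltn_trans (isT : 1 < 4) p5).
have j0 : j != 0%R by apply: deg0 degj _; lia.
have [x _] : exists x : T, x \in T by apply/card_gt0P; rewrite cardT; lia.
have [d dx] : exists d, d != x.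
  have : 0 < #|[set~ x]| by rewrite cardsC1 cardT; lia.
  by case/card_gt0P => d; rewrite !inE; exists d.
have [e ex] := rank3_suborbits transG i0 j0 ij charG dx.
set B := orbit _ _ d; set C := orbit _ _ e => /= SO.
have sdx : perm_eq (subdegrees G x) [:: 1; #|B|; #|C|].
  by rewrite /subdegrees (perm_trans (perm_map _ SO)) //= cards1.
have sum3 : 1 + #|B| + #|C| = 3 * p.
  rewrite -cardT -cardsT (card_partition (suborbits_partition G x)).
  by rewrite -big_enum (perm_big _ SO) /= !big_cons big_nil cards1 addn0 addnA.
have C0 : 0 < #|C| by apply/card_gt0P; exists e; apply: orbit_refl.
have B0 : 0 < #|B| by apply/card_gt0P; exists d; apply: orbit_refl.
have degij : ('chi_i 1%g != 'chi_j 1%g)%R.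
  by rewrite degi degj Num.Theory.eqr_nat; clear -p5; lia.
have /= [r [s []]] := rank3_eigenvalues transG i0 j0 ij charG dx degij.
rewrite degi degj cardT -/B.
(* This makes the truncated subtraction in [2 * p - 1] a true one over [algC]. *)
have p0 : 0 < 2 * p by rewrite muln_gt0 (ltn_trans _ p5).
rewrite GRing.natrB // GRing.natrM => E1 E2.
have intE1 : (#|B|%:Z + p%:Z * r + (2 * p%:Z - 1) * s = 0)%R.
  by apply: (@intr_inj algC); rewrite -[RHS]E1; ring.
have intE2 : (#|B|%:Z ^+ 2 + p%:Z * r ^+ 2 + (2 * p%:Z - 1) * s ^+ 2 =
              3 * p%:Z * #|B|%:Z)%R.
  apply: (@intr_inj algC); rewrite GRing.natrM in E2.
  by apply: etrans (etrans E2 _); ring.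
have Blt : #|B| < 3 * p - 1 by clear -sum3 C0; lia.
have trans_sd y : perm_eq (subdegrees G y) [:: 1; #|B|; #|C|].
  by have [g Gg <-] := transG_ex transG x y; rewrite (perm_trans (subdegrees_perm x Gg)).
have [a aE] := eigenvalue_arith podd B0 Blt intE1 intE2.
have CE : #|C| = 3 * p - 1 - #|B| by clear -sum3; lia.
rewrite CE in trans_sd.
(* [d] was any point other than [x], so [B] may be either nontrivial suborbit and the lengths may
   come in either order. *)
have swap (m n : nat) : perm_eq [:: 1; m; n] [:: 1; n; m].
  by rewrite perm_cons; apply: (permEl (perm_rcons n [:: m])).
exists a; case: aE => -[pE kE]; [left|right]; split=> // y;
    apply: (perm_trans (trans_sd y)); case: kE => kE; clear -kE pE swap.
- rewrite kE (_ : 3 * p - 1 - _ = 2 * p - 4 * a - 2) //; clear -pE; lia.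
- rewrite kE (_ : 3 * p - 1 - _ = p + 4 * a + 1) //; clear -pE; lia.
- rewrite kE (_ : 3 * p - 1 - _ = 2 * p + 4 * a + 2) //; clear -pE; lia.
- rewrite kE (_ : 3 * p - 1 - _ = p - 4 * a - 3) //; clear -pE; lia.
Qed.
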